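(* Let $L$ be a valid lattice. For any positive integer $n$ and any real numbers $u_0,u_1$, $$p_{[nL,E]}(n u_0,\,n u_1)=\prod_{0\le i,j<n}p_{[L,E]}\Big(u_0+\frac{i}{n},\,u_1-\frac{j}{n}\Big).$$
   Context: A valid lattice is a subgroup $L\subset\mathbb{Z}^2$ generated by two linearly independent vectors, each of which has both coordinates even or both coordinates odd. For a valid lattice $L$, let $x_0>0$ be the smallest positive integer with $v_0=(x_0,0)\in L$, let $y_1$ be the smallest positive integer such that $L$ contains a vector with second coordinate $y_1$, and let $v_1=(x_1,y_1)$ be the unique such vector in $L$ with $0\le x_1<x_0$. Then $\{v_0,v_1\}$ generates $L$ and $x_0$ is even. Let $L_0$ be the lattice generated by $(2,0),(1,1)$, $L_b=L_0+(\frac12,\frac12)$ and $L_w=L_0+(\frac12,-\frac12)$. Given $u_0,u_1\in\mathbb{R}$ put $q_m=\exp(2\pi \mathbf{i}\,u_m)$ ($\mathbf i$ the imaginary unit) and let $q:L\to\mathbb{S}^1$ be the homomorphism with $q(v_0)=q_1^{-1}$, $q(v_1)=q_0$. Let $\mathcal{B}(L,q)$ (resp. $\mathcal{W}(L,q)$) be the space of functions $f:L_b\to\mathbb{C}$ (resp. $L_w\to\mathbb{C}$) with $f(u+v)=q(v)f(u)$ for all $v\in L$. The (Kasteleyn) linear map $K:\mathcal{B}(L,q)\to\mathcal{W}(L,q)$ is $$(Kg)(x,y)=g(x+1,y)-g(x-1,y)+g(x,y+1)+g(x,y-1).$$ For integers $0\le k_0<\frac12x_0$, $0\le k_1<y_1$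 let $\zeta[k_0,k_1](v)=\exp(2\pi\mathbf{i}\langle z,v\rangle)$ with $$z=\Big(\frac{k_0-u_1}{x_0},\ \frac{(u_0+k_1)x_0+(u_1-k_0)x_1}{x_0y_1}\Big).$$ The restrictions of these functions to $L_b$ form a basis $E_b$ of $\mathcal{B}(L,q)$ and their restrictions to $L_w$ form a basis $E_w$ of $\mathcal{W}(L,q)$ (ordered by the same ordering of the pairs $(k_0,k_1)$). $K_E(u_0,u_1)$ is the matrix of $K$ with respect to $E_b$ and $E_w$ (it is diagonal), and $p_{[L,E]}:\mathbb{R}^2\to\mathbb{C}$ is $p_{[L,E]}(u_0,u_1)=\det K_E(u_0,u_1)$. $p_{[nL,E]}$ is the same construction applied to the valid lattice $nL$. *)

(* Defs.v *)
From HB Require Import structures.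
From mathcomp Require Import all_boot all_order all_algebra.
From mathcomp Require Import boolp classical_sets functions reals trigo.
From mathcomp Require Import complex.
From mathcomp Require Import zify ring lra.

Set Implicit Arguments.
Unset Strict Implicit.
Unset Printing Implicit Defensive.

Import Order.TTheory GRing.Theory Num.Theory.

Local Open Scope classical_set_scope.
Local Open Scope ring_scope.
Local Open Scope complex_scope.

Definition zspan (v w : int * int) : set (int * int) :=
  [set u | exists a b : int, u = v *~ a + w *~ b].

Definition zindep (v w : int * int) : Prop :=
  forall a b : int, v *~ a + w *~ b = 0 -> a = 0 /\ b = 0.

Definition same_parity (v : int * int) : bool :=
  (2 %| v.1)%Z == (2 %| v.2)%Z.

Definition valid (L : set (int * int)) : Prop :=
  exists v w, [/\ same_parity v, same_parity w, zindep v w & L = zspan v w].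

Record valid_lattice := ValidLattice {
  lat :> set (int * int);
  lat_valid : valid lat }.

Lemma mulrz_pair (v : int * int) (a : int) : v *~ a = (v.1 * a, v.2 * a).
Proof.
have mE m (z : int * int) : z *+ m = (z.1 * m%:Z, z.2 * m%:Z).
  elim: m => [|m IH]; first by rewrite mulr0n !mulr0.
  by rewrite mulrS IH -[LHS]/(_, _) /=; congr pair; lia.
case: a => m; first by rewrite -pmulrn mE.
rewrite NegzE mulrNz -pmulrn mE -[LHS]/(_, _) /=; congr pair; lia.
Qed.

Lemma zspanP (v w u : int * int) : zspan v w u <->
  exists a b : int, u = (v.1 * a + w.1 * b, v.2 * a + w.2 * b).
Proof.
by split=> -[a [b ->]]; exists a, b; rewrite !mulrz_pair.
Qed.

Lemma zspanD v w u u' : zspan v w u -> zspan v w u' -> zspan v w (u + u').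
Proof.
move=> [a [b ->]] [a' [b' ->]]; exists (a + a'), (b + b').
by rewrite !mulrzDr addrACA.
Qed.

Lemma zspanZ v w u (c : int) : zspan v w u -> zspan v w (u *~ c).
Proof.
by move=> [a [b ->]]; exists (a * c), (b * c); rewrite mulrzDl -!mulrzA.
Qed.

Lemma latticeD (L : valid_lattice) v w : lat L v -> lat L w -> lat L (v + w).
Proof. by case: L => L [a [b [_ _ _ /= ->]]]; exact: zspanD. Qed.

Lemma latticeZ (L : valid_lattice) v (c : int) : lat L v -> lat L (v *~ c).
Proof. by case: L => L [a [b [_ _ _ /= ->]]]; exact: zspanZ. Qed.

Lemma zindep_det v w : zindep v w -> v.1 * w.2 - v.2 * w.1 != 0.
Proof.
move=> ind; apply/eqP => d0.
have [w20 v20] : w.2 = 0 /\ - v.2 = 0.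
  by apply: ind; rewrite !mulrz_pair -[LHS]/(_, _) /=; congr pair; lia.
have [w10 v10] : w.1 = 0 /\ - v.1 = 0.
  by apply: ind; rewrite !mulrz_pair -[LHS]/(_, _) /=; congr pair; lia.
have [//] : 1 = 0 :> int /\ 0 = 0 :> int.
apply: ind; rewrite !mulrz_pair -[LHS]/(_, _) /=; congr pair; lia.
Qed.

Lemma x0_exists (L : valid_lattice) :
  exists x : nat, `[< (0 < x)%N /\ lat L (x%:Z, 0) >].
Proof.
case: L => L [v [w [_ _ ind /= ->]]].
have := zindep_det ind; set d := _ - _ => d0.
have Ld : zspan v w (d, 0).
  by apply/zspanP; exists w.2, (- v.2); congr pair; rewrite /d; lia.
exists `|d|%N; apply/asboolP; split; first by rewrite absz_gt0.
case: (leP 0 d) => ds.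
  by rewrite (_ : _%:Z = d) //; lia.
rewrite (_ : (_, 0) = (d, 0) *~ (-1)); first exact: zspanZ.
by rewrite mulrz_pair /=; congr pair; lia.
Qed.

Definition x0 (L : valid_lattice) : nat := ex_minn (x0_exists L).

Lemma y1_exists (L : valid_lattice) :
  exists y : nat, `[< (0 < y)%N /\ exists x : int, lat L (x, y%:Z) >].
Proof.
case: L => L [v [w [_ _ ind /= ->]]].
suff [u [Lu u2]] : exists u, zspan v w u /\ u.2 != 0.
  exists `|u.2|%N; apply/asboolP; split; first by rewrite absz_gt0.
  case: (leP 0 u.2) => us.
    by exists u.1; rewrite (_ : (_, _) = u) // [RHS]surjective_pairing;
       congr pair; lia.
  exists (- u.1); rewrite (_ : (_, _) = u *~ (-1)); first exact: zspanZ.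
  by rewrite mulrz_pair; congr pair; lia.
have := zindep_det ind => d0.
have [v20|v2] := eqVneq v.2 0; last first.
  exists v; split=> //; apply/zspanP; exists 1, 0.
  by rewrite [LHS]surjective_pairing; congr pair; lia.
exists w; split; last by apply: contraNN d0 => /eqP ->; rewrite v20; lia.
apply/zspanP; exists 0, 1.
by rewrite [LHS]surjective_pairing; congr pair; lia.
Qed.

Definition y1 (L : valid_lattice) : nat := ex_minn (y1_exists L).

Lemma x0P (L : valid_lattice) : [/\ (0 < x0 L)%N, lat L ((x0 L)%:Z, 0) &
  forall x : nat, (0 < x)%N -> lat L (x%:Z, 0) -> (x0 L <= x)%N].
Proof.
rewrite /x0; case: ex_minnP => m /asboolP [m0 Lm] mle; split=> // x xp Lx.
by apply: mle; apply/asboolP.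
Qed.

Lemma y1P (L : valid_lattice) :
  [/\ (0 < y1 L)%N, exists x : int, lat L (x, (y1 L)%:Z) &
  forall y : nat, (0 < y)%N -> (exists x : int, lat L (x, y%:Z)) -> (y1 L <= y)%N].
Proof.
rewrite /y1; case: ex_minnP => m /asboolP [m0 Lm] mle; split=> // x xp Lx.
by apply: mle; apply/asboolP.
Qed.

Lemma x1_exists (L : valid_lattice) :
  exists x : nat, `[< (x < x0 L)%N /\ lat L (x%:Z, (y1 L)%:Z) >].
Proof.
have [x0p Lx0 _] := x0P L; have [_ [x Lx] _] := y1P L.
have x0z : (x0 L)%:Z != 0 by lia.
exists `|(x %% (x0 L)%:Z)%Z|%N; apply/asboolP.
have m0 := modz_ge0 x x0z; have mlt := @ltz_pmod x (x0 L)%:Z ltac:(lia).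
split; first by lia.
rewrite (_ : (_, _) = (x, (y1 L)%:Z) + ((x0 L)%:Z, 0) *~ (- (x %/ (x0 L)%:Z)%Z)).
  by apply: latticeD => //; exact: latticeZ.
rewrite mulrz_pair -[RHS]/(_, _) /=; congr pair; last by lia.
by have := divz_eq x (x0 L)%:Z; lia.
Qed.

(* The choice is harmless: see [x1_unique]. *)
Definition x1 (L : valid_lattice) : nat := xchoose (x1_exists L).

Lemma x1P (L : valid_lattice) : (x1 L < x0 L)%N /\ lat L ((x1 L)%:Z, (y1 L)%:Z).
Proof. exact/asboolP/(xchooseP (x1_exists L)). Qed.

Lemma x1_unique (L : valid_lattice) (x : nat) :
  (x < x0 L)%N -> lat L (x%:Z, (y1 L)%:Z) -> x = x1 L.
Proof.
have [_ _ x0m] := x0P L; have [x1lt L1] := x1P L.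
have main (s t : nat) : (s < x0 L)%N -> lat L (s%:Z, (y1 L)%:Z) ->
    lat L (t%:Z, (y1 L)%:Z) -> (s <= t)%N.
  move=> slt Ls Lt; rewrite leqNgt; apply/negP => ts.
  have := x0m (s - t)%N ltac:(lia).
  rewrite (_ : (_, 0) = (s%:Z, (y1 L)%:Z) + (t%:Z, (y1 L)%:Z) *~ (-1)).
    by move=> /(_ (latticeD Ls (latticeZ _ Lt))); lia.
  by rewrite mulrz_pair -[RHS]/(_, _) /=; congr pair; lia.
by move=> xlt Lx; apply/eqP; rewrite eqn_leq; apply/andP;
   split; exact: main.
Qed.

Definition v0 (L : valid_lattice) : int * int := ((x0 L)%:Z, 0).
Definition v1 (L : valid_lattice) : int * int := ((x1 L)%:Z, (y1 L)%:Z).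

Lemma v0v1_generate (L : valid_lattice) v :
  lat L v -> exists a b : int, v = v0 L *~ a + v1 L *~ b.
Proof.
move=> Lv; have [x0p Lx0 x0m] := x0P L; have [y1p _ y1m] := y1P L.
have [_ Lv1] := x1P L.
have y1z : (y1 L)%:Z != 0 by lia.
have x0z : (x0 L)%:Z != 0 by lia.
pose b := (v.2 %/ (y1 L)%:Z)%Z; pose c := v.1 - (x1 L)%:Z * b.
pose a := (c %/ (x0 L)%:Z)%Z.
have Ew : v + v1 L *~ (- b) = (c, (v.2 %% (y1 L)%:Z)%Z).
  rewrite mulrz_pair [LHS]surjective_pairing /=; congr pair; first by rewrite /c; lia.
  by have := divz_eq v.2 (y1 L)%:Z; rewrite -/b; lia.
have Lw : lat L (c, (v.2 %% (y1 L)%:Z)%Z).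
  by rewrite -Ew; apply: latticeD => //; exact: latticeZ.
have m0 := modz_ge0 v.2 y1z; have mlt := @ltz_pmod v.2 (y1 L)%:Z ltac:(lia).
have r0 : (v.2 %% (y1 L)%:Z)%Z = 0.
  apply/eqP; apply/negPn/negP => rn0.
  have := y1m `|(v.2 %% (y1 L)%:Z)%Z|%N ltac:(lia).
  suff : exists x : int, lat L (x, `|(v.2 %% (y1 L)%:Z)%Z|%N%:Z).
    by move=> h /(_ h); lia.
  by exists c; rewrite gez0_abs.
rewrite r0 in Lw.
have Lw' : lat L ((c %% (x0 L)%:Z)%Z, 0).
  rewrite (_ : (_, _) = (c, 0) + v0 L *~ (- a)); last first.
    rewrite mulrz_pair [RHS]surjective_pairing /=; congr pair; last by lia.
    by have := divz_eq c (x0 L)%:Z; rewrite -/a; lia.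
  by apply: latticeD => //; exact: latticeZ.
have n0 := modz_ge0 c x0z; have nlt := @ltz_pmod c (x0 L)%:Z ltac:(lia).
have s0 : (c %% (x0 L)%:Z)%Z = 0.
  apply/eqP; apply/negPn/negP => rn0.
  have := x0m `|(c %% (x0 L)%:Z)%Z|%N ltac:(lia).
  by rewrite gez0_abs // => /(_ Lw'); lia.
exists a, b; rewrite !mulrz_pair [LHS]surjective_pairing [RHS]surjective_pairing /=.
have := divz_eq c (x0 L)%:Z; have := divz_eq v.2 (y1 L)%:Z.
by rewrite r0 s0 -/a -/b => e1 e2; congr pair; move: e1 e2; rewrite /c; lia.
Qed.

Definition scale_set (n : nat) (L : set (int * int)) : set (int * int) :=
  [set v *+ n | v in L].

Lemma scale_valid (n : nat) (L : valid_lattice) :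
  (0 < n)%N -> valid (scale_set n L).
Proof.
move=> n0; case: L => L [v [w [pv pw ind /= ->]]].
exists (v *+ n), (w *+ n).
have sp u : same_parity u -> same_parity (u *+ n).
  have := mulrz_pair u n; rewrite -pmulrn => ->.
  by rewrite /same_parity /= !dvdzE !abszM !Euclid_dvdM // => /eqP ->.
split; [exact: sp|exact: sp| |].
  move=> a b; rewrite !pmulrn -!mulrzA ![(n%:Z * _)%R]mulrC => /ind [ea eb].
  by split; apply/eqP; [move/eqP: ea|move/eqP: eb]; rewrite mulf_eq0; lia.
apply/seteqP; split=> u.
  move=> [_ [a [b ->]] <-]; exists a, b.
  by rewrite !pmulrn mulrzDl -!mulrzA ![(n%:Z * _)%R]mulrC.
move=> [a [b ->]]; exists (v *~ a + w *~ b); first by exists a, b.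
by rewrite !pmulrn mulrzDl -!mulrzA ![(n%:Z * _)%R]mulrC.
Qed.

Definition scale (n : nat) (n_gt0 : (0 < n)%N) (L : valid_lattice) :
  valid_lattice := ValidLattice (scale_valid L n_gt0).

Definition emb (R : realType) (v : int * int) : R * R := (v.1%:~R, v.2%:~R).

Definition L0 : set (int * int) := zspan (2, 0) (1, 1).

Definition Lb (R : realType) : set (R * R) :=
  [set emb R v + (2^-1, 2^-1) | v in L0].
Definition Lw (R : realType) : set (R * R) :=
  [set emb R v + (2^-1, - 2^-1) | v in L0].
Arguments Lb : clear implicits.
Arguments Lw : clear implicits.

Lemma Lw_shift (R : realType) (d : int * int) (u : R * R) :
  ~~ same_parity d -> u \in Lw R -> u + emb R d \in Lb R.
Proof.
move=> pd /set_mem [v /zspanP /= [a [b ->]]] <-; apply/mem_set.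
exists (2 * a + b + d.1, b + d.2 - 1); last first.
  rewrite /emb -[LHS]/(_, _) -[RHS]/(_, _) /= !rmorphB !rmorphD /= ?mul0r ?mul1r.
  by congr pair; rewrite ?rmorphD ?rmorphM /=; lra.
apply/zspanP; exists ((2 * a + d.1 - d.2 + 1) %/ 2)%Z, (b + d.2 - 1).
move: pd; rewrite /same_parity => /eqP pd.
by congr pair => /=; lia.
Qed.

(* The vertex u + d; [hd] makes it black when u is white. *)
Definition w2b (R : realType) (d : int * int) (hd : ~~ same_parity d)
  (u : Lw R) : Lb R := exist _ (val u + emb R d) (Lw_shift hd (valP u)).

Definition expi (R : realType) (t : R) : R[i] := cos t +i* sin t.

(* exp(2 i pi u), through Euler's formula. *)
Definition qexp (R : realType) (u : R) : R[i] := expi (2 * pi * u).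

Definition is_character (R : realType) (L : set (int * int))
  (q : int * int -> R[i]) : Prop :=
  (forall v, L v -> `|q v| = 1) /\
  (forall v w, L v -> L w -> q (v + w) = q v * q w).

(* The homomorphism q : L -> S^1 attached to (u0, u1); its values outside [L]
   are irrelevant.  It exists and is unique on [L] by [qhomP] and
   [qhom_unique]. *)
Definition qhom (R : realType) (L : valid_lattice) (u0 u1 : R) :
  int * int -> R[i] :=
  xget (fun=> 1) [set q | [/\ is_character L q,
    q (v0 L) = (qexp u1)^-1 & q (v1 L) = qexp u0]].

(* f (u + v) = q v * f u for v in L, for functions f defined on S only: the
   point u + v is given as an element u' of the subtype S. For S = Lb, Lw and
   a valid lattice L it always exists, because L is contained in L0. *)
Definition qperiodic (R : realType) (S : set (R * R)) (L : set (int * int))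
  (q : int * int -> R[i]) : {pred (S -> (R[i])^o)} :=
  fun f => `[< forall v, L v -> forall u u' : S,
                 val u' = val u + emb R v -> f u' = q v * f u >].

Lemma qperiodic_submod_closed (R : realType) (S : set (R * R))
  (L : set (int * int)) (q : int * int -> R[i]) :
  submod_closed (@qperiodic R S L q).
Proof.
split; first by apply/asboolP => v Lv u u' e; rewrite /= mulr0.
move=> a f g /asboolP fP /asboolP gP; apply/asboolP => v Lv u u' e.
have E x : (a *: f + g) x = a * f x + g x by [].
rewrite !E (fP v Lv u u' e) (gP v Lv u u' e).
by rewrite mulrDr mulrCA.
Qed.

HB.instance Definition _ (R : realType) (S : set (R * R))
  (L : set (int * int)) (q : int * int -> R[i]) :=
  GRing.isSubmodClosed.Build R[i] (S -> (R[i])^o) (@qperiodic R S L q)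
    (@qperiodic_submod_closed R S L q).

Record qpfun (R : realType) (S : set (R * R)) (L : set (int * int))
  (q : int * int -> R[i]) := QPFun {
  qpfun_val :> S -> (R[i])^o;
  qpfun_valP : qpfun_val \in qperiodic L q }.

HB.instance Definition _ (R : realType) (S : set (R * R))
  (L : set (int * int)) (q : int * int -> R[i]) :=
  [isSub for @qpfun_val R S L q].
HB.instance Definition _ (R : realType) (S : set (R * R))
  (L : set (int * int)) (q : int * int -> R[i]) :=
  [Choice of @qpfun R S L q by <:].
HB.instance Definition _ (R : realType) (S : set (R * R))
  (L : set (int * int)) (q : int * int -> R[i]) :=
  [SubChoice_isSubLmodule of @qpfun R S L q by <:].

(* The spaces B(L, q) and W(L, q). *)
Definition Bfun (R : realType) (L : set (int * int)) (q : int * int -> R[i]) :=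
  qpfun (Lb R) L q.
Definition Wfun (R : realType) (L : set (int * int)) (q : int * int -> R[i]) :=
  qpfun (Lw R) L q.

HB.instance Definition _ (R : realType) (L : set (int * int))
  (q : int * int -> R[i]) :=
  GRing.Lmodule.on (@Bfun R L q).
HB.instance Definition _ (R : realType) (L : set (int * int))
  (q : int * int -> R[i]) :=
  GRing.Lmodule.on (@Wfun R L q).

Definition kast_fun (R : realType) (g : Lb R -> (R[i])^o) :
  Lw R -> (R[i])^o := fun u =>
  g (@w2b R (1, 0) isT u) - g (@w2b R (-1, 0) isT u)
  + g (@w2b R (0, 1) isT u) + g (@w2b R (0, -1) isT u).

Lemma kast_qperiodic (R : realType) (L : set (int * int))
  (q : int * int -> R[i])
  (g : Bfun L q) : kast_fun g \in @qperiodic R (Lw R) L q.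
Proof.
have /asboolP gP := qpfun_valP g.
apply/asboolP => v Lv u u' e.
have E d (hd : ~~ same_parity d) : g (w2b hd u') = q v * g (w2b hd u).
  by apply: (gP v Lv) => /=; rewrite e addrAC.
by rewrite /kast_fun !E; ring.
Qed.

Definition kast (R : realType) (L : set (int * int))
  (q : int * int -> R[i]) (g : Bfun L q) :
  Wfun L q := QPFun (kast_qperiodic g).

Lemma kast_linear (R : realType) (L : set (int * int))
  (q : int * int -> R[i]) :
  linear (@kast R L q).
Proof.
move=> a f g; apply: val_inj => /=; apply/funext => u.
transitivity (kast_fun (fun x => a * f x + g x) u); first by [].
transitivity (a * kast_fun f u + kast_fun g u); last by [].
by rewrite /kast_fun; ring.
Qed.

HB.instance Definition _ (R : realType) (L : set (int * int))
  (q : int * int -> R[i]) :=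
  GRing.isLinear.Build R[i] (Bfun L q) (Wfun L q) *:%R (@kast R L q)
    (@kast_linear R L q).

(* The vector z attached to (k0, k1). *)
Definition zvec (R : realType) (L : valid_lattice) (u0 u1 : R) (k0 k1 : nat) :
  R * R :=
  ((k0%:R - u1) / (x0 L)%:R,
   ((u0 + k1%:R) * (x0 L)%:R + (u1 - k0%:R) * (x1 L)%:R)
     / ((x0 L)%:R * (y1 L)%:R)).

Definition inner (R : realType) (z v : R * R) : R := z.1 * v.1 + z.2 * v.2.

Definition zeta (R : realType) (L : valid_lattice) (u0 u1 : R) (k0 k1 : nat)
  (v : R * R) : R[i] := qexp (inner (zvec L u0 u1 k0 k1) v).

Lemma qexp0 (R : realType) : qexp (0 : R) = 1.
Proof. by rewrite /qexp /expi mulr0 cos0 sin0. Qed.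

Lemma qexpD (R : realType) (s t : R) : qexp (s + t) = qexp s * qexp t.
Proof.
rewrite /qexp /expi mulrDr cosD sinD; set a := 2 * pi * s; set b := 2 * pi * t.
rewrite -[RHS]/((cos a * cos b - sin a * sin b) +i*
                (cos a * sin b + sin a * cos b)).
by congr Complex; ring.
Qed.

Lemma qexpVN (R : realType) (t : R) : (qexp t)^-1 = qexp (- t).
Proof.
have h : qexp t * qexp (- t) = 1 by rewrite -qexpD subrr qexp0.
have n0 : qexp t != 0.
  by apply: contra_eqN h => /eqP ->; rewrite mul0r eq_sym oner_eq0.
by apply: (mulfI n0); rewrite h mulfV.
Qed.

Lemma qexp1 (R : realType) : qexp (1 : R) = 1.
Proof.
by rewrite /qexp /expi mulr1 (_ : 2 * pi = pi *+ 2) ?cos2pi ?sin2pi //; ring.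
Qed.

Lemma qexp_nat (R : realType) (n : nat) : qexp (n%:R : R) = 1.
Proof. by elim: n => [|n IH]; rewrite ?qexp0 // -natr1 qexpD IH qexp1 mulr1. Qed.

Lemma norm_qexp (R : realType) (t : R) : `|qexp t| = 1.
Proof. by rewrite normc_def /= cos2Dsin2 sqrtr1. Qed.

Lemma qexp_eq1 (R : realType) (t : R) : `|t| < 1 -> qexp t = 1 -> t = 0.
Proof.
move=> t1 /(congr1 (@complex.Re R)) /= c1.
have p0 := pi_gt0 R.
have s0 : sin (pi * `|t|) = 0.
  have e : cos (2 * pi * t) = 1 - sin (pi * t) ^+ 2 *+ 2.
    have := cos2Dsin2 (pi * t).
    rewrite (_ : 2 * pi * t = pi * t + pi * t); last by ring.
    by rewrite cosD !expr2; lra.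
  have : sin (pi * t) ^+ 2 = 0 by move: e; rewrite c1; lra.
  move=> /eqP; rewrite sqrf_eq0 => /eqP e0.
  by case: (ger0P t) => _ //; rewrite mulrN sinN e0 oppr0.
apply/eqP/negPn/negP => tn0.
have : 0 < sin (pi * `|t|).
  apply: sin_gt0_pi; rewrite ?mulr_gt0 ?normr_gt0 //=.
  by rewrite -[ltRHS]mulr1 ltr_pM2l.
by rewrite s0 ltxx.
Qed.

Lemma zetaD (R : realType) L (u0 u1 : R) k0 k1 v w :
  zeta L u0 u1 k0 k1 (v + w) = zeta L u0 u1 k0 k1 v * zeta L u0 u1 k0 k1 w.
Proof. by rewrite /zeta -qexpD /inner /=; congr qexp; ring. Qed.

Lemma embD (R : realType) v w : emb R (v + w) = emb R v + emb R w.
Proof. by rewrite /emb /= !rmorphD. Qed.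

Lemma zeta_v0 (R : realType) L (u0 u1 : R) k0 k1 :
  zeta L u0 u1 k0 k1 (emb R (v0 L)) = (qexp u1)^-1.
Proof.
have [x0p _ _] := x0P L.
have x0n : (x0 L)%:R != 0 :> R by rewrite pnatr_eq0 -lt0n.
rewrite /zeta /inner /= mulr0 addr0 -pmulrn divfK // qexpD qexp_nat mul1r.
by rewrite qexpVN.
Qed.

Lemma zeta_v1 (R : realType) L (u0 u1 : R) k0 k1 :
  zeta L u0 u1 k0 k1 (emb R (v1 L)) = qexp u0.
Proof.
have [x0p _ _] := x0P L; have [y1p _ _] := y1P L.
have x0n : (x0 L)%:R != 0 :> R by rewrite pnatr_eq0 -lt0n.
have y1n : (y1 L)%:R != 0 :> R by rewrite pnatr_eq0 -lt0n.
rewrite /zeta /inner /= -!pmulrn -[RHS]mulr1 -(qexp_nat R k1) -qexpD.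
by congr qexp; field; rewrite x0n y1n.
Qed.

Lemma zeta_character (R : realType) L (u0 u1 : R) k0 k1 (A : set (int * int)) :
  is_character A (fun v => zeta L u0 u1 k0 k1 (emb R v)).
Proof.
split=> [v _|v w _ _]; first exact: norm_qexp.
by rewrite embD zetaD.
Qed.

Lemma character_neq0 (R : realType) (A : set (int * int))
  (q : int * int -> R[i]) v : is_character A q -> A v -> q v != 0.
Proof. by move=> [n _] /n e; rewrite -normr_eq0 e oner_eq0. Qed.

Lemma qhom_unique (R : realType) (L : valid_lattice) (q q' : int * int -> R[i]) :
  is_character L q -> is_character L q' ->
  q (v0 L) = q' (v0 L) -> q (v1 L) = q' (v1 L) ->
  forall v, lat L v -> q v = q' v.
Proof.
move=> cq cq' e0 e1.
have L00 : lat L 0 by rewrite -(mulr0z (v0 L)); apply: latticeZ; case: (x0P L).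
have q1 r : is_character L r -> r 0 = 1.
  move=> cr; apply: (mulfI (character_neq0 cr L00)).
  by rewrite -cr.2 // addr0 mulr1.
have agree v : lat L v -> q v = q' v -> forall a : int, q (v *~ a) = q' (v *~ a).
  move=> Lv e a.
  have nat_case n : q (v *+ n) = q' (v *+ n).
    elim: n => [|n IH]; first by rewrite mulr0n !q1.
    have Ln : lat L (v *+ n) by rewrite pmulrn; exact: latticeZ.
    by rewrite mulrS cq.2 // cq'.2 // e IH.
  case: a => n; first exact: nat_case.
  have Ln : lat L (v *+ n.+1) by rewrite pmulrn; exact: latticeZ.
  have LN : lat L (v *~ Negz n) by exact: latticeZ.
  apply: (mulfI (character_neq0 cq Ln)).
  rewrite -cq.2 // nat_case -cq'.2 //.
  by rewrite NegzE mulrNz -pmulrn subrr !q1.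
move=> v /v0v1_generate [a [b ->]].
have L0' : lat L (v0 L) by case: (x0P L).
have L1' : lat L (v1 L) by case: (x1P L).
rewrite cq.2 ?cq'.2 //; try exact: latticeZ.
by rewrite !agree.
Qed.

Lemma qhomP (R : realType) (L : valid_lattice) (u0 u1 : R) :
  [/\ is_character L (qhom L u0 u1),
      qhom L u0 u1 (v0 L) = (qexp u1)^-1 & qhom L u0 u1 (v1 L) = qexp u0].
Proof.
rewrite /qhom; case: xgetP => [q -> //|].
move=> /(_ (fun v => zeta L u0 u1 0 0 (emb R v))) [].
by split; [exact: zeta_character|exact: zeta_v0|exact: zeta_v1].
Qed.

Lemma zeta_qhom (R : realType) (L : valid_lattice) (u0 u1 : R) k0 k1 v :
  lat L v -> zeta L u0 u1 k0 k1 (emb R v) = qhom L u0 u1 v.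
Proof.
have [cq q0 q1] := qhomP L u0 u1.
apply: (qhom_unique (zeta_character L u0 u1 k0 k1 L) cq).
  by rewrite zeta_v0 q0.
by rewrite zeta_v1 q1.
Qed.

Lemma zeta_qperiodic (R : realType) (S : set (R * R)) L (u0 u1 : R) k0 k1 :
  (fun u : S => zeta L u0 u1 k0 k1 (val u) : (R[i])^o)
    \in @qperiodic R S L (qhom L u0 u1).
Proof.
apply/asboolP => v Lv u u' ->.
by rewrite zetaD zeta_qhom // mulrC.
Qed.

Definition zeta_restr (R : realType) (S : set (R * R)) (L : valid_lattice)
  (u0 u1 : R) (k0 k1 : nat) : qpfun S L (qhom L u0 u1) :=
  QPFun (@zeta_qperiodic R S L u0 u1 k0 k1).

(* The pairs (k0, k1) with 0 <= k0 < x_0 / 2 and 0 <= k1 < y_1;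
   halving is exact by [x0_even]. *)
Definition kindex (L : valid_lattice) : finType :=
  ('I_(x0 L)./2 * 'I_(y1 L))%type.

Lemma lattice_parity (L : valid_lattice) v : lat L v -> same_parity v.
Proof.
have parE u : same_parity u <-> exists k : int, u.1 = u.2 + 2 * k.
  rewrite /same_parity; split=> [/eqP h|[k ->]]; last by apply/eqP; lia.
  by exists ((u.1 - u.2) %/ 2)%Z; lia.
case: L => L [a [b [/parE[k ek] /parE[l el] _ /= ->]]].
move=> /zspanP[c [d ->]]; apply/parE; exists (k * c + l * d) => /=.
by rewrite ek el; ring.
Qed.

Lemma x0_even (L : valid_lattice) : ~~ odd (x0 L).
Proof.
have [_ /lattice_parity + _] := x0P L.
by rewrite /same_parity /= => /eqP; lia.
Qed.

Definition Eb (R : realType) (L : valid_lattice) (u0 u1 : R)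
  (i : 'I_#|kindex L|) : Bfun L (qhom L u0 u1) :=
  zeta_restr (Lb R) L u0 u1 (enum_val i).1 (enum_val i).2.

Definition Ew (R : realType) (L : valid_lattice) (u0 u1 : R)
  (i : 'I_#|kindex L|) : Wfun L (qhom L u0 u1) :=
  zeta_restr (Lw R) L u0 u1 (enum_val i).1 (enum_val i).2.

Arguments Eb {R} L u0 u1 i.
Arguments Ew {R} L u0 u1 i.

(* The matrix of [T] with respect to the bases [e] and [f]: its j-th column holds
   the coordinates of T (e j). The default 0 plays no role below, since the matrix
   exists and is unique for the Kasteleyn map ([KEP], [KE_unique]). *)
Definition matrix_wrt (F : fieldType) (V W : lmodType F) (m n : nat)
  (e : 'I_n -> V) (f : 'I_m -> W) (T : V -> W) : 'M[F]_(m, n) :=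
  xget 0 [set M : 'M[F]_(m, n) | forall j, T (e j) = \sum_i M i j *: f i].

Definition KE (R : realType) (L : valid_lattice) (u0 u1 : R) :
  'M[R[i]]_#|kindex L| :=
  matrix_wrt (Eb L u0 u1) (Ew L u0 u1) (@kast R L (qhom L u0 u1)).

Definition Kev (R : realType) (L : valid_lattice) (u0 u1 : R) (k0 k1 : nat) :
  R[i] :=
  let ev d := zeta L u0 u1 k0 k1 (emb R d) in
  ev (1, 0) - ev (-1, 0) + ev (0, 1) + ev (0, -1).

Lemma kast_Eb (R : realType) (L : valid_lattice) (u0 u1 : R) j :
  kast (Eb L u0 u1 j) =
  Kev L u0 u1 (enum_val j).1 (enum_val j).2 *: Ew L u0 u1 j.
Proof.
apply: val_inj; apply/funext => u /=.
rewrite -[RHS]/(_ * zeta _ _ _ _ _ _) /kast_fun /= !zetaD /Kev; ring.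
Qed.

Lemma character_indep (R : realType) (I : eqType) (chi : I -> int * int -> R[i]) :
  (forall i, is_character L0 (chi i)) ->
  (forall i j, (forall w, L0 w -> chi i w = chi j w) -> i = j) ->
  forall (s : seq I) (a : I -> R[i]), uniq s ->
  (forall v, L0 v -> \sum_(i <- s) a i * chi i v = 0) ->
  forall i, i \in s -> a i = 0.
Proof.
move=> cchi inj; elim=> // j s IH a /= /andP[js us] h.
have L00 : L0 0 by exists 0, 0.
have as0 i : i \in s -> a i = 0.
  move=> si; apply/eqP/negPn/negP => ai0.
  have ij : i <> j by move=> e; rewrite -e si in js.
  apply: ij; apply: inj => w Lw.
  have := IH (fun i => a i * (chi i w - chi j w)) us _ i si.
  move=> /(_ _) H; apply/eqP; rewrite -subr_eq0.
  suff /H/eqP : forall v, L0 v ->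
      \sum_(i <- s) a i * (chi i w - chi j w) * chi i v = 0.
    by rewrite mulf_eq0 (negPf ai0).
  move=> v Lv; have := h _ (zspanD Lw Lv); have := h _ Lv.
  rewrite !big_cons (cchi j).2 // => e1 e2.
  transitivity (\sum_(i <- s) a i * chi i (w + v)
                - chi j w * \sum_(i <- s) a i * chi i v).
    rewrite big_distrr /= -sumrB; apply: eq_bigr => l _.
    by rewrite (cchi l).2 //; ring.
  have -> : \sum_(i <- s) a i * chi i v = - (a j * chi j v).
    by apply/eqP; rewrite -addr_eq0 addrC e1.
  have -> : \sum_(i <- s) a i * chi i (w + v) = - (a j * (chi j w * chi j v)).
    by apply/eqP; rewrite -addr_eq0 addrC e2.
  by ring.
move=> i; rewrite inE => /orP[/eqP ->|]; last exact: as0.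
have := h 0 L00; rewrite big_cons big_seq big1 ?addr0; last first.
  by move=> l ls; rewrite as0 // mul0r.
move/eqP; rewrite mulf_eq0 (negPf (character_neq0 (cchi j) L00)) orbF.
by move/eqP.
Qed.

Lemma zeta_inj (R : realType) (L : valid_lattice) (u0 u1 : R)
  (i j : 'I_#|kindex L|) :
  (forall w, L0 w ->
     zeta L u0 u1 (enum_val i).1 (enum_val i).2 (emb R w) =
     zeta L u0 u1 (enum_val j).1 (enum_val j).2 (emb R w)) -> i = j.
Proof.
move=> h; apply: enum_val_inj.
move: (enum_val i) (enum_val j) h => [k0 k1] [l0 l1] /= h.
have [x0p _ _] := x0P L; have [y1p _ _] := y1P L.
have x0r : 0 < (x0 L)%:R :> R by rewrite ltr0n.
have y1r : 0 < (y1 L)%:R :> R by rewrite ltr0n.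
have x0n := lt0r_neq0 x0r; have y1n := lt0r_neq0 y1r.
have hd w (t : R) : L0 w ->
    t = inner (zvec L u0 u1 k0 k1) (emb R w) - inner (zvec L u0 u1 l0 l1) (emb R w) ->
    `|t| < 1 -> t = 0.
  move=> Lw et t1; apply: qexp_eq1 => //.
  by rewrite et qexpD -qexpVN; have := h w Lw; rewrite /zeta => ->;
     rewrite qexpVN -qexpD subrr qexp0.
have lt_half (k : 'I_(x0 L)./2) : (2 * k < x0 L)%N.
  by have := ltn_ord k; have := odd_double_half (x0 L); lia.
have e0 : k0 = l0.
  have := hd (2, 0) (2 * (k0%:R - l0%:R) / (x0 L)%:R).
  have Lw : L0 (2, 0) by apply/zspanP; exists 1, 0.
  move=> /(_ Lw) H; apply: val_inj => /=.
  have {}H : 2 * (k0%:R - l0%:R) / (x0 L)%:R = 0 :> R.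
    apply: H; first by rewrite /inner /= ; field; rewrite x0n y1n.
    rewrite normrM normfV (gtr0_norm x0r) ltr_pdivrMr // mul1r.
    have := lt_half k0; have := lt_half l0.
    rewrite -!(ltr_nat R) !natrM => h1 h2.
    have : 0 <= k0%:R :> R by []. have : 0 <= l0%:R :> R by [].
    by rewrite ltr_norml; move: h1 h2; lra.
  apply/eqP; rewrite -(eqr_nat R) -subr_eq0.
  by move/eqP: H; rewrite !mulf_eq0 invr_eq0 (negPf x0n) orbF pnatr_eq0.
subst l0; congr pair; apply: val_inj => /=.
have Lw : L0 (1, 1) by apply/zspanP; exists 0, 1.
have H : (k1%:R - l1%:R) / (y1 L)%:R = 0 :> R.
  apply: (hd (1, 1)) => //; first by rewrite /inner /= ; field; rewrite x0n y1n.
  rewrite normrM normfV (gtr0_norm y1r) ltr_pdivrMr // mul1r.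
  have := ltn_ord k1; have := ltn_ord l1.
  rewrite -!(ltr_nat R) => h1 h2.
  have : 0 <= k1%:R :> R by []. have : 0 <= l1%:R :> R by [].
  by rewrite ltr_norml; move: h1 h2; lra.
apply/eqP; rewrite -(eqr_nat R) -subr_eq0.
by move/eqP: H; rewrite !mulf_eq0 invr_eq0 (negPf y1n) orbF.
Qed.

Lemma zeta_restr_free (R : realType) (S : set (R * R)) (L : valid_lattice)
  (u0 u1 : R) (c : R * R) (a : 'I_#|kindex L| -> R[i]) :
  (forall v, L0 v -> S (emb R v + c)) ->
  \sum_i a i *: zeta_restr S L u0 u1 (enum_val i).1 (enum_val i).2 = 0 ->
  forall i, a i = 0.
Proof.
move=> Sc e.
have ev u : \sum_i a i * zeta L u0 u1 (enum_val i).1 (enum_val i).2 (val (u : S)) = 0.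
  pose phi (f : qpfun S L (qhom L u0 u1)) : R[i] := f u.
  have phiD : {morph phi : f g / f + g} by [].
  have phi0 : phi 0 = 0 by [].
  transitivity (phi (\sum_i a i *: zeta_restr S L u0 u1
    (enum_val i).1 (enum_val i).2)); last by rewrite e.
  by rewrite (big_morph phi phiD phi0).
pose b i := a i * zeta L u0 u1 (enum_val i).1 (enum_val i).2 c.
move=> i; have : b i = 0.
  pose chi (i : 'I_#|kindex L|) v :=
    zeta L u0 u1 (enum_val i).1 (enum_val i).2 (emb R v).
  have cchi k : is_character L0 (chi k) by exact: zeta_character.
  have ichi k l : (forall w, L0 w -> chi k w = chi l w) -> k = l.
    exact: zeta_inj.
  apply: (character_indep cchi ichi (index_enum_uniq _)); last first.
    exact: mem_index_enum.
  move=> v Lv.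
  apply: etrans (ev (exist _ (emb R v + c) (mem_set (Sc v Lv)))) => /=.
  by apply: eq_bigr => k _; rewrite /b zetaD mulrAC mulrA.
move=> /eqP; rewrite mulf_eq0 => /orP[/eqP //|/eqP z0].
have := norm_qexp (inner (zvec L u0 u1 (enum_val i).1 (enum_val i).2) c).
by rewrite -/(zeta _ _ _ _ _ _) z0 normr0 => /eqP; rewrite eq_sym oner_eq0.
Qed.

Lemma Eb_free (R : realType) (L : valid_lattice) (u0 u1 : R) a :
  \sum_i a i *: Eb L u0 u1 i = 0 -> forall i, a i = 0.
Proof. by apply: zeta_restr_free => v Lv; exists v. Qed.

Lemma Ew_free (R : realType) (L : valid_lattice) (u0 u1 : R) a :
  \sum_i a i *: Ew L u0 u1 i = 0 -> forall i, a i = 0.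
Proof. by apply: zeta_restr_free => v Lv; exists v. Qed.

Lemma KEP (R : realType) (L : valid_lattice) (u0 u1 : R) j :
  kast (Eb L u0 u1 j) = \sum_i KE L u0 u1 i j *: Ew L u0 u1 i.
Proof.
rewrite /KE /matrix_wrt; case: xgetP => [M -> //|].
move=> /(_ (\matrix_(i < #|kindex L|, j < #|kindex L|)
  (Kev L u0 u1 (enum_val j).1 (enum_val j).2 *+ (i == j)))) [] k.
rewrite kast_Eb (bigD1 k) //= mxE eqxx mulr1n big1 ?addr0 // => l lk.
by rewrite mxE (negPf lk) mulr0n scale0r.
Qed.

Lemma KE_unique (R : realType) (L : valid_lattice) (u0 u1 : R)
  (M : 'M[R[i]]_#|kindex L|) :
  (forall j, kast (Eb L u0 u1 j) = \sum_i M i j *: Ew L u0 u1 i) ->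
  M = KE L u0 u1.
Proof.
move=> h; apply/matrixP => i j; apply/eqP; rewrite -subr_eq0; apply/eqP.
move: i; apply: (@Ew_free R L u0 u1 (fun i => M i j - KE L u0 u1 i j)).
under eq_bigr do rewrite scalerBl.
by rewrite sumrB -h -KEP subrr.
Qed.

Definition pLE (R : realType) (L : valid_lattice) (u0 u1 : R) : R[i] :=
  \det (KE L u0 u1).

(* Main.v *)
(* In the bases E_b and E_w the Kasteleyn matrix is diagonal and its entry at
   (k0, k1) depends only on the vector z. The data x0, x1, y1 of nL are n times
   those of L, so writing an index pair of nL as (n k0 + j, n k1 + i) with
   0 <= i, j < n, its vector z at (n u0, n u1) is the vector z of L with index
   (k0, k1) at (u0 + i/n, u1 - j/n). *)
Require Import Defs.
From mathcomp Require Import all_boot all_order all_algebra.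
From mathcomp Require Import reals complex.
From mathcomp Require Import zify ring.
Import Order.TTheory GRing.Theory Num.Theory.
Local Open Scope ring_scope.

Lemma lat_scaleP (L : valid_lattice) (n : nat) (n_gt0 : (0 < n)%N) (a b : int) :
  lat (scale n_gt0 L) (a, b) <->
  exists c d : int, [/\ lat L (c, d), a = c * n%:Z & b = d * n%:Z].
Proof.
split=> [[[c d] Lcd]|[c [d [Lcd -> ->]]]].
  by rewrite pmulrn mulrz_pair /= => -[<- <-]; exists c, d.
by exists (c, d) => //; rewrite pmulrn mulrz_pair.
Qed.

(** Minimality works both ways: [n] times the shortest horizontal vector of [L] competes in [nL],
    and that of [nL] divided by [n] competes in [L]. *)
Lemma x0_scale (L : valid_lattice) (n : nat) (n_gt0 : (0 < n)%N) :
  x0 (scale n_gt0 L) = (x0 L * n)%N.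
Proof.
have [x0p Lx0 x0m] := x0P L.
have [s0p /lat_scaleP [c [d [Lcd ec ed]]] s0m] := x0P (scale n_gt0 L).
have d0 : d = 0 by nia.
have cp : 0 < c by nia.
apply/eqP; rewrite eqn_leq; apply/andP; split.
  apply: s0m; first by rewrite muln_gt0 x0p.
  by apply/lat_scaleP; exists (x0 L)%:Z, 0; split => //; lia.
have := x0m `|c|%N ltac:(lia).
rewrite gtz0_abs // -d0 => /(_ Lcd); nia.
Qed.

Lemma y1_scale (L : valid_lattice) (n : nat) (n_gt0 : (0 < n)%N) :
  y1 (scale n_gt0 L) = (y1 L * n)%N.
Proof.
have [y1p [x Lx] y1m] := y1P L.
have [s1p [t /lat_scaleP [c [d [Lcd ec ed]]]] s1m] := y1P (scale n_gt0 L).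
have dp : 0 < d by nia.
apply/eqP; rewrite eqn_leq; apply/andP; split.
  apply: s1m; first by rewrite muln_gt0 y1p.
  by exists (x * n%:Z); apply/lat_scaleP; exists x, (y1 L)%:Z; split => //; lia.
have := y1m `|d|%N ltac:(lia).
by rewrite gtz0_abs // => /(_ (ex_intro _ c Lcd)); nia.
Qed.

Lemma x1_scale (L : valid_lattice) (n : nat) (n_gt0 : (0 < n)%N) :
  x1 (scale n_gt0 L) = (x1 L * n)%N.
Proof.
have [x1lt Lx1] := x1P L.
apply/esym/x1_unique; first by rewrite x0_scale ltn_pmul2r.
rewrite y1_scale; apply/lat_scaleP; exists (x1 L)%:Z, (y1 L)%:Z.
by split=> //; lia.
Qed.

(** By [kast_Eb] the diagonal matrix of the [Kev] represents [kast], so [KE_unique] identifies it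
    with [KE]. Ranges of naturals prepare for division with remainder. *)
Lemma pLE_prod (R : realType) (L : valid_lattice) (u0 u1 : R) :
  pLE L u0 u1 =
  \prod_(0 <= k0 < (x0 L)./2) \prod_(0 <= k1 < y1 L) Kev L u0 u1 k0 k1.
Proof.
pose ev j := Kev L u0 u1 (@enum_val (kindex L) predT j).1
                         (@enum_val (kindex L) predT j).2.
rewrite /pLE -(@KE_unique R L u0 u1 (diag_mx (\row_j ev j))); last first.
  move=> j; rewrite kast_Eb (bigD1 j) //= !mxE eqxx mulr1n big1 ?addr0 // => k kj.
  by rewrite !mxE (negPf kj) mulr0n scale0r.
rewrite det_diag; under eq_bigr do rewrite mxE.
rewrite -(big_enum_val (fun k : kindex L => Kev L u0 u1 k.1 k.2)) /=.
rewrite big_mkord; under [RHS]eq_bigr do rewrite big_mkord.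
by rewrite pair_big; apply: eq_bigl => k.
Qed.

(** The remainder is the outer index: it fixes the shift of [u0] or [u1], and the quotients then run
    through a full range for [L]. *)
Lemma big_nat_mul_mod (T : Type) (idx : T) (op : Monoid.com_law idx)
    (m n : nat) (F : nat -> T) :
  \big[op/idx]_(0 <= k < m * n) F k =
  \big[op/idx]_(0 <= j < n) \big[op/idx]_(0 <= k < m) F (k * n + j)%N.
Proof.
rewrite exchange_big_nat /= big_nat_mul; apply: eq_bigr => k _.
by rewrite -{1}[(k * n)%N]add0n big_addn mulSn addnK; under eq_bigr do rewrite addnC.
Qed.

(** A factor [n] cancels in the first coordinate and [n ^ 2] in the second. [u1] enters as [k0 - u1]
    and [u0] as [u0 + k1], hence the opposite signs of the shifts. *)
Lemma zvec_scale (R : realType) (L : valid_lattice) (n : nat)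
    (n_gt0 : (0 < n)%N) (u0 u1 : R) (i j k0 k1 : nat) :
  zvec (scale n_gt0 L) (n%:R * u0) (n%:R * u1) (k0 * n + j) (k1 * n + i) =
  zvec L (u0 + i%:R / n%:R) (u1 - j%:R / n%:R) k0 k1.
Proof.
have [x0p _ _] := x0P L; have [y1p _ _] := y1P L.
have x0n : (x0 L)%:R != 0 :> R by rewrite pnatr_eq0 -lt0n.
have y1n : (y1 L)%:R != 0 :> R by rewrite pnatr_eq0 -lt0n.
have nn : n%:R != 0 :> R by rewrite pnatr_eq0 -lt0n.
rewrite /zvec x0_scale x1_scale y1_scale !natrD !natrM.
by congr pair; field; rewrite ?nn ?x0n ?y1n.
Qed.

Theorem theorem3 (R : realType) (L : valid_lattice) (n : nat)
    (n_gt0 : (0 < n)%N) (u0 u1 : R) :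
  pLE (scale n_gt0 L) (n%:R * u0) (n%:R * u1) =
  \prod_(i < n) \prod_(j < n)
    pLE L (u0 + i%:R / n%:R) (u1 - j%:R / n%:R).
Proof.
(* Rounding down would break this for odd [x0 L]. *)
have half_x0 : (x0 L * n)./2 = ((x0 L)./2 * n)%N.
  by rewrite -{1}(even_halfK (x0_even L)) -doubleMl doubleK.
(* [j] goes outside because it is the remainder of [k0], the outer index in [pLE_prod]. *)
rewrite exchange_big pLE_prod x0_scale y1_scale half_x0 big_nat_mul_mod big_mkord.
apply: eq_bigr => j _.
under eq_bigr do rewrite big_nat_mul_mod.
rewrite exchange_big_nat big_mkord; apply: eq_bigr => i _.
rewrite pLE_prod; apply: eq_bigr => k0 _; apply: eq_bigr => k1 _.
by rewrite /Kev /zeta zvec_scale.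
Qed.
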